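(* Let $x,y\in[0,1]$. A formula $\phi$ over $\{\mathbf 0,\neg,\wedge,\vee,\rightarrow\}$ (resp. over $\{\mathbf 0,\neg,\wedge,\vee,\rightsquigarrow\}$) is $\mathsf{L}^2_{(x,y)}(\rightarrow)$-valid (resp. $\mathsf{L}^2_{(x,y)}(\rightsquigarrow)$-valid) if and only if $\phi$ has a $\mathcal T(\mathsf{L}^2_{(x,y)})$ proof.
   Context: **Semantics.** Formulas are built from a countable set $\mathsf{Prop}$ of propositional letters and the constant $\mathbf 0$ with unary $\neg$ and binary $\wedge,\vee$, $\rightarrow$ (strong implication), $\rightsquigarrow$ (weak implication). A valuation is a map $v:\mathsf{Prop}\to[0,1]\times[0,1]$, $v=(v_1,v_2)$, extended by - $v(\mathbf 0)=(0,1)$, $v(\neg\phi)=(v_2(\phi),v_1(\phi))$; - $v(\phi\wedge\psi)=(\min(v_1(\phi),v_1(\psi)),\max(v_2(\phi),v_2(\psi)))$; - $v(\phi\vee\psi)=(\max(v_1(\phi),v_1(\psi)),\min(v_2(\phi),v_2(\psi)))$; - $v(\phi\rightarrow\psi)=(\min(1,1-v_1(\phi)+v_1(\psi)),\max(0,v_2(\psi)-v_2(\phi)))$; - $v(\phi\rightsquigarrow\psi)=(\min(1,1-v_1(\phi)+v_1(\psi)),\max(0,v_1(\phi)+v_2(\psi)-1))$. Let $(x,y)^\uparrow=\{(x',y')\in[0,1]^2: x\le x',\ y'\le y\}$. A formula $\phi$ over $\{\mathbf 0,\neg,\wedge,\vee,\rightarrow\}$ (resp. $\{\mathbf 0,\neg,\wedge,\vee,\rightsquigarrow\}$)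 is $\mathsf{L}^2_{(x,y)}(\rightarrow)$-valid (resp. $\mathsf{L}^2_{(x,y)}(\rightsquigarrow)$-valid) iff $v(\phi)\in(x,y)^\uparrow$ for every valuation $v$. **Tableaux.** A tableau is a downward branching tree; each branch is a non-empty set of entries. Entries are labelled formulas $\phi\leqslant_k i$ or $\phi\geqslant_k i$ with $k\in\{1,2\}$ (intended meaning: $v_k(\phi)\le i$, resp. $v_k(\phi)\ge i$), and numerical constraints (linear inequalities, possibly strict) between labels. Labels $i$ are linear expressions with real coefficients in auxiliary variables ranging over $[0,1]$. A branch containing the premise of a rule may be extended by the conclusions; ''$|$'' denotes splitting of the branch, a comma means that all listed entries are added, and $j$ is always a fresh auxiliary variable ranging over $[0,1]$. Rules (''premise $\Rightarrow$ conclusion''): - $\mathbf 0\leqslant_1 i\Rightarrow 0\le i$; $\mathbf 0\leqslant_2 i\Rightarrow 1\le i$; $\mathbf 0\geqslant_1 i\Rightarrow 0\ge i$; $\mathbf 0\geqslant_2 i\Rightarrow 1\ge i$. - $\neg\phi\leqslant_1 i\Rightarrow\phi\leqslant_2 i$; $\neg\phi\leqslant_2 i\Rightarrow\phi\leqslant_1 i$; $\neg\phi\geqslant_1 i\Rightarrow\phi\geqslant_2 i$; $\neg\phi\geqslant_2 i\Rightarrow\phi\geqslant_1 i$. - $\phi_1\rightarrow\phi_2\leqslant_1 i\Rightarrow i\ge1\ |\ \phi_1\geqslant_1 1-i+j,\ \phi_2\leqslant_1 j,\ j\le i$. - $\phi_1\rightarrow\phi_2\leqslant_2 i\Rightarrow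 \phi_1\geqslant_2 j,\ \phi_2\leqslant_2 i+j$. - $\phi_1\rightarrow\phi_2\geqslant_1 i\Rightarrow \phi_1\leqslant_1 1-i+j,\ \phi_2\geqslant_1 j$. - $\phi_1\rightarrow\phi_2\geqslant_2 i\Rightarrow i\le0\ |\ \phi_1\leqslant_2 j,\ \phi_2\geqslant_2 i+j,\ j\le1-i$. - $\phi_1\rightsquigarrow\phi_2\leqslant_1 i\Rightarrow i\ge1\ |\ \phi_1\geqslant_1 1-i+j,\ \phi_2\leqslant_1 j,\ j\le i$. - $\phi_1\rightsquigarrow\phi_2\leqslant_2 i\Rightarrow \phi_1\leqslant_1 i+j,\ \phi_2\leqslant_2 1-j$. - $\phi_1\rightsquigarrow\phi_2\geqslant_1 i\Rightarrow \phi_1\leqslant_1 1-i+j,\ \phi_2\geqslant_1 j$. - $\phi_1\rightsquigarrow\phi_2\geqslant_2 i\Rightarrow i\le0\ |\ \phi_1\geqslant_1 i+j,\ \phi_2\geqslant_2 1-j,\ j\le1-i$. - $\phi_1\wedge\phi_2\leqslant_1 i\Rightarrow\phi_1\leqslant_1 i\ |\ \phi_2\leqslant_1 i$; $\phi_1\wedge\phi_2\leqslant_2 i\Rightarrow\phi_1\leqslant_2 i,\ \phi_2\leqslant_2 i$; $\phi_1\wedge\phi_2\geqslant_1 i\Rightarrow\phi_1\geqslant_1 i,\ \phi_2\geqslant_1 i$; $\phi_1\wedge\phi_2\geqslant_2 i\Rightarrow\phi_1\geqslant_2 i\ |\ \phi_2\geqslant_2 i$. - $\phi_1\vee\phi_2\leqslant_1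 i\Rightarrow\phi_1\leqslant_1 i,\ \phi_2\leqslant_1 i$; $\phi_1\vee\phi_2\leqslant_2 i\Rightarrow\phi_1\leqslant_2 i\ |\ \phi_2\leqslant_2 i$; $\phi_1\vee\phi_2\geqslant_1 i\Rightarrow\phi_1\geqslant_1 i\ |\ \phi_2\geqslant_1 i$; $\phi_1\vee\phi_2\geqslant_2 i\Rightarrow\phi_1\geqslant_2 i,\ \phi_2\geqslant_2 i$. For every formula $\phi$ let $x^L_\phi,x^R_\phi$ be variables ranging over $[0,1]$, and translate $\phi\leqslant_1 i$, $\phi\geqslant_1 i$, $\phi\leqslant_2 i$, $\phi\geqslant_2 i$ into $x^L_\phi\le i$, $x^L_\phi\ge i$, $x^R_\phi\le i$, $x^R_\phi\ge i$ respectively. A branch is closed if the system consisting of the translations of all its labelled formulas together with all its numerical constraints has no solution (all variables ranging over $[0,1]$). A tableau is closed if all its branches are closed. A formula $\phi$ has a $\mathcal T(\mathsf{L}^2_{(x,y)})$ proof if there are closed tableaux beginning with $\{\phi\leqslant_1 c,\ c<x\}$ and with $\{\phi\geqslant_2 d,\ d>y\}$, where $c,d$ are auxiliary variables ranging over $[0,1]$. *)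

(* Defs.v *)
From Stdlib Require Import Reals List.
Import ListNotations.
Open Scope R_scope.

Inductive formula : Type :=
| Var (p : nat)
| Zero
| Neg (f : formula)
| And (f g : formula)
| Or (f g : formula)
| SImp (f g : formula)   (* strong implication *)
| WImp (f g : formula).  (* weak implication *)

Fixpoint over_strong (f : formula) : Prop :=
  match f with
  | Var _ | Zero => True
  | Neg f => over_strong f
  | And f g | Or f g | SImp f g => over_strong f /\ over_strong g
  | WImp _ _ => False
  end.

Fixpoint over_weak (f : formula) : Prop :=
  match f with
  | Var _ | Zero => True
  | Neg f => over_weak f
  | And f g | Or f g | WImp f g => over_weak f /\ over_weak g
  | SImp _ _ => False
  end.

Definition unit_interval (r : R) : Prop := 0 <= r <= 1.

Definition unit_square (p : R * R) : Prop :=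
  unit_interval (fst p) /\ unit_interval (snd p).

Definition is_valuation (v : nat -> R * R) : Prop :=
  forall p, unit_square (v p).

Fixpoint eval (v : nat -> R * R) (f : formula) : R * R :=
  match f with
  | Var p => v p
  | Zero => (0, 1)
  | Neg f => (snd (eval v f), fst (eval v f))
  | And f g =>
      (Rmin (fst (eval v f)) (fst (eval v g)),
       Rmax (snd (eval v f)) (snd (eval v g)))
  | Or f g =>
      (Rmax (fst (eval v f)) (fst (eval v g)),
       Rmin (snd (eval v f)) (snd (eval v g)))
  | SImp f g =>
      (Rmin 1 (1 - fst (eval v f) + fst (eval v g)),
       Rmax 0 (snd (eval v g) - snd (eval v f)))
  | WImp f g =>
      (Rmin 1 (1 - fst (eval v f) + fst (eval v g)),
       Rmax 0 (fst (eval v f) + snd (eval v g) - 1))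
  end.

Definition upset (x y : R) (p : R * R) : Prop :=
  unit_square p /\ x <= fst p /\ snd p <= y.

(* Both notions of validity (for the strong and for the weak language) are this
   one predicate, restricted to formulas of the respective language. *)
Definition valid (x y : R) (f : formula) : Prop :=
  forall v, is_valuation v -> upset x y (eval v f).

(* Labels: linear expressions, constant term allowed, with real coefficients;
   auxiliary variables are numbered by nat. *)
Inductive label : Type :=
| Lcst (r : R)
| Lvar (n : nat)
| Ladd (i j : label)
| Lscale (r : R) (i : label).

Declare Scope label_scope.
Delimit Scope label_scope with label.
Bind Scope label_scope with label.
Notation "i + j" := (Ladd i j) : label_scope.
Notation "i - j" := (Ladd i (Lscale (-1) j)) : label_scope.
Notation "0" := (Lcst 0) : label_scope.
Notation "1" := (Lcst 1) : label_scope.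

Fixpoint label_value (a : nat -> R) (i : label) : R :=
  match i with
  | Lcst r => r
  | Lvar n => a n
  | Ladd i j => label_value a i + label_value a j
  | Lscale r i => r * label_value a i
  end.

Fixpoint occurs_in_label (n : nat) (i : label) : Prop :=
  match i with
  | Lcst _ => False
  | Lvar m => n = m
  | Ladd i j => occurs_in_label n i \/ occurs_in_label n j
  | Lscale _ i => occurs_in_label n i
  end.

(* The subscript k = 1, 2 of a labelled formula. *)
Inductive coord : Type := K1 | K2.

Inductive entry : Type :=
| Fle (k : coord) (f : formula) (i : label)   (* f <=_k i *)
| Fge (k : coord) (f : formula) (i : label)   (* f >=_k i *)
| Nle (i j : label)                           (* i <= j *)
| Nlt (i j : label).                          (* i < j *)

Definition occurs_in_entry (n : nat) (e : entry) : Prop :=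
  match e with
  | Fle _ _ i | Fge _ _ i => occurs_in_label n i
  | Nle i j | Nlt i j => occurs_in_label n i \/ occurs_in_label n j
  end.

(* Finite set of entries, read through In. *)
Definition branch : Type := list entry.

Definition fresh (n : nat) (B : branch) : Prop :=
  forall e, In e B -> ~ occurs_in_entry n e.

(* [rule B e Cs]: on the branch B, a rule with premise e has the alternatives Cs,
   each of them a list of entries to be added. B only matters for freshness. *)
Inductive rule (B : branch) : entry -> list (list entry) -> Prop :=
| Zero_le1 i : rule B (Fle K1 Zero i) [[Nle 0 i]]
| Zero_le2 i : rule B (Fle K2 Zero i) [[Nle 1 i]]
| Zero_ge1 i : rule B (Fge K1 Zero i) [[Nle i 0]]
| Zero_ge2 i : rule B (Fge K2 Zero i) [[Nle i 1]]

| Neg_le1 f i : rule B (Fle K1 (Neg f) i) [[Fle K2 f i]]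
| Neg_le2 f i : rule B (Fle K2 (Neg f) i) [[Fle K1 f i]]
| Neg_ge1 f i : rule B (Fge K1 (Neg f) i) [[Fge K2 f i]]
| Neg_ge2 f i : rule B (Fge K2 (Neg f) i) [[Fge K1 f i]]

| SImp_le1 f g i j : fresh j B ->
    rule B (Fle K1 (SImp f g) i)
      [[Nle 1 i];
       [Fge K1 f (1 - i + Lvar j); Fle K1 g (Lvar j); Nle (Lvar j) i]]
| SImp_le2 f g i j : fresh j B ->
    rule B (Fle K2 (SImp f g) i)
      [[Fge K2 f (Lvar j); Fle K2 g (i + Lvar j)]]
| SImp_ge1 f g i j : fresh j B ->
    rule B (Fge K1 (SImp f g) i)
      [[Fle K1 f (1 - i + Lvar j); Fge K1 g (Lvar j)]]
| SImp_ge2 f g i j : fresh j B ->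
    rule B (Fge K2 (SImp f g) i)
      [[Nle i 0];
       [Fle K2 f (Lvar j); Fge K2 g (i + Lvar j); Nle (Lvar j) (1 - i)]]

| WImp_le1 f g i j : fresh j B ->
    rule B (Fle K1 (WImp f g) i)
      [[Nle 1 i];
       [Fge K1 f (1 - i + Lvar j); Fle K1 g (Lvar j); Nle (Lvar j) i]]
| WImp_le2 f g i j : fresh j B ->
    rule B (Fle K2 (WImp f g) i)
      [[Fle K1 f (i + Lvar j); Fle K2 g (1 - Lvar j)]]
| WImp_ge1 f g i j : fresh j B ->
    rule B (Fge K1 (WImp f g) i)
      [[Fle K1 f (1 - i + Lvar j); Fge K1 g (Lvar j)]]
| WImp_ge2 f g i j : fresh j B ->
    rule B (Fge K2 (WImp f g) i)
      [[Nle i 0];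
       [Fge K1 f (i + Lvar j); Fge K2 g (1 - Lvar j); Nle (Lvar j) (1 - i)]]

| And_le1 f g i : rule B (Fle K1 (And f g) i) [[Fle K1 f i]; [Fle K1 g i]]
| And_le2 f g i : rule B (Fle K2 (And f g) i) [[Fle K2 f i; Fle K2 g i]]
| And_ge1 f g i : rule B (Fge K1 (And f g) i) [[Fge K1 f i; Fge K1 g i]]
| And_ge2 f g i : rule B (Fge K2 (And f g) i) [[Fge K2 f i]; [Fge K2 g i]]

| Or_le1 f g i : rule B (Fle K1 (Or f g) i) [[Fle K1 f i; Fle K1 g i]]
| Or_le2 f g i : rule B (Fle K2 (Or f g) i) [[Fle K2 f i]; [Fle K2 g i]]
| Or_ge1 f g i : rule B (Fge K1 (Or f g) i) [[Fge K1 f i]; [Fge K1 g i]]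
| Or_ge2 f g i : rule B (Fge K2 (Or f g) i) [[Fge K2 f i; Fge K2 g i]].

(* [tableau B]: the finite tableaux beginning with the entries B; in a subtree, B
   collects all entries on the path from the root. Every rule has one or two
   alternatives, hence the two extension constructors. *)
Inductive tableau (B : branch) : Type :=
| Leaf : tableau B
| Extend (e : entry) (C : list entry) :
    In e B -> rule B e [C] -> tableau (C ++ B) -> tableau B
| Split (e : entry) (C1 C2 : list entry) :
    In e B -> rule B e [C1; C2] ->
    tableau (C1 ++ B) -> tableau (C2 ++ B) -> tableau B.

Fixpoint branches {B : branch} (T : tableau B) : list branch :=
  match T with
  | Leaf _ => [B]
  | Extend _ _ _ _ _ T' => branches T'
  | Split _ _ _ _ _ _ T1 T2 => branches T1 ++ branches T2
  end.

(* [a n] is the value of the n-th auxiliary variable; [X K1 f] and [X K2 f] are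
   the values of the variables x^L_f and x^R_f, independent of one another. *)
Definition holds (a : nat -> R) (X : coord -> formula -> R) (e : entry) : Prop :=
  match e with
  | Fle k f i => X k f <= label_value a i
  | Fge k f i => label_value a i <= X k f
  | Nle i j => label_value a i <= label_value a j
  | Nlt i j => label_value a i < label_value a j
  end.

Definition branch_closed (B : branch) : Prop :=
  ~ exists (a : nat -> R) (X : coord -> formula -> R),
      (forall n, unit_interval (a n)) /\
      (forall k f, unit_interval (X k f)) /\
      (forall e, In e B -> holds a X e).

Definition closed {B : branch} (T : tableau B) : Prop :=
  forall B', In B' (branches T) -> branch_closed B'.

Definition has_proof (x y : R) (f : formula) : Prop :=
  (exists (c : nat)
     (T : tableau [Fle K1 f (Lvar c); Nlt (Lvar c) (Lcst x)]), closed T) /\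
  (exists (d : nat)
     (T : tableau [Fge K2 f (Lvar d); Nlt (Lcst y) (Lvar d)]), closed T).

(* Main.v *)
Require Import Defs.
From Stdlib Require Import Reals.
From Stdlib Require Import List Lia Lra.
Import ListNotations.
Open Scope R_scope.

(** Fix a valuation [v]. For labels in the unit interval, every rule is an
    equivalence: its premise is true under [v] exactly when one of its alternatives
    is, for a suitable value of the fresh variable.

    Read downwards ([rule_preserves_truth]), this gives soundness: a valuation
    refuting [f] makes one of the two roots true, its truth is passed down along
    some branch, and the values [truth v] of all formulas then solve the system
    of that branch, which therefore is not closed.

    Read upwards ([rule_reflects_truth]), it gives completeness. Decomposing compound
    formulas terminates, and a solution [X] of the system of a fully decomposed
    branch need not be compositional, but its values at the propositional letters
    define a valuation. Going up from the letters, that valuation makes every entry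
    of the branch true, in particular the root; so if [f] is valid there is no such
    solution. There is one subtlety: the conclusions of some rules do not bound the
    label [i] of the premise. In the rule for [f -> g <=_2 i], for example, they
    give [g - f <= i], whereas truth of the premise also needs [0 <= i]. This bound
    comes from the translation of the premise itself, which belongs to the branch and
    compares [i] with a variable ranging over the unit interval.

    The argument for completeness is organised as the construction of a closed
    tableau for a branch of which only some entries are still to be decomposed
    ([closed_tableau_of_pending]). *)

(** * Valuations as solutions of branches *)

Definition truth (v : nat -> R * R) (k : coord) (f : formula) : R :=
  match k with
  | K1 => fst (eval v f)
  | K2 => snd (eval v f)
  end.

Definition unit_valued (X : coord -> formula -> R) : Prop :=
  forall k f, unit_interval (X k f).

Definition all_hold (a : nat -> R) (X : coord -> formula -> R) (B : list entry) :
  Prop := forall e, In e B -> holds a X e.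

Ltac split_minmax :=
  unfold Rmin, Rmax in *;
  repeat match goal with
    | |- context [Rle_dec ?r ?s] => destruct (Rle_dec r s)
    | H : context [Rle_dec ?r ?s] |- _ => destruct (Rle_dec r s)
    end.

Lemma eval_unit_square v : is_valuation v -> forall f, unit_square (eval v f).
Proof.
  intros Hv f; unfold unit_square, unit_interval.
  induction f; simpl; try apply Hv; split_minmax; lra.
Qed.

Lemma truth_unit_valued v : is_valuation v -> unit_valued (truth v).
Proof. intros Hv [|] f; apply (eval_unit_square v Hv f). Qed.

Lemma all_hold_app a X C B :
  all_hold a X (C ++ B) <-> all_hold a X C /\ all_hold a X B.
Proof.
  unfold all_hold; split.
  - intros H; split; intros e He; apply H, in_app_iff; auto.
  - intros [HC HB] e He; apply in_app_iff in He as [He|He]; auto.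
Qed.

(** * Fresh auxiliary variables *)

Definition update (a : nat -> R) (j : nat) (r : R) : nat -> R :=
  fun n => if Nat.eqb n j then r else a n.

Lemma update_same a j r : update a j r j = r.
Proof. unfold update; now rewrite Nat.eqb_refl. Qed.

Lemma label_value_update a j r i :
  ~ occurs_in_label j i -> label_value (update a j r) i = label_value a i.
Proof.
  induction i as [s|n|i IHi i' IHi'|s i IHi]; simpl; intros H.
  - reflexivity.
  - unfold update; destruct (Nat.eqb_spec n j); [subst; tauto | reflexivity].
  - now rewrite IHi, IHi' by tauto.
  - now rewrite IHi by tauto.
Qed.

Lemma holds_update a j r X e :
  ~ occurs_in_entry j e -> holds (update a j r) X e <-> holds a X e.
Proof.
  destruct e; simpl; intros H; rewrite !label_value_update by tauto; tauto.
Qed.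

Lemma choose_fresh a X B j r :
  (forall n, unit_interval (a n)) -> all_hold a X B -> fresh j B ->
  unit_interval r ->
  exists a', (forall n, unit_interval (a' n)) /\ all_hold a' X B /\ a' j = r.
Proof.
  intros Ha HB Hj Hr; exists (update a j r); split; [|split].
  - intros n; unfold update; destruct (Nat.eqb n j); auto.
  - intros e He; apply holds_update; auto.
  - apply update_same.
Qed.

Fixpoint label_bound (i : label) : nat :=
  match i with
  | Lcst _ => 0
  | Lvar n => S n
  | Ladd i j => Nat.max (label_bound i) (label_bound j)
  | Lscale _ i => label_bound i
  end.

Lemma occurs_lt_label_bound n i : occurs_in_label n i -> (n < label_bound i)%nat.
Proof.
  induction i; simpl; intros H; [tauto | lia | | auto].
  destruct H as [H|H]; [apply IHi1 in H | apply IHi2 in H]; lia.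
Qed.

Definition entry_bound (e : entry) : nat :=
  match e with
  | Fle _ _ i | Fge _ _ i => label_bound i
  | Nle i j | Nlt i j => Nat.max (label_bound i) (label_bound j)
  end.

Lemma occurs_lt_entry_bound n e : occurs_in_entry n e -> (n < entry_bound e)%nat.
Proof.
  destruct e as [k f i|k f i|i j|i j]; simpl; try apply occurs_lt_label_bound;
    intros [H|H]; apply occurs_lt_label_bound in H; lia.
Qed.

Lemma fresh_exists B : exists j, fresh j B.
Proof.
  exists (list_max (map entry_bound B)); intros e He Hocc.
  apply occurs_lt_entry_bound in Hocc.
  assert (H := proj1 (list_max_le (map entry_bound B) _) (le_n _)).
  rewrite Forall_map, Forall_forall in H; specialize (H e He); lia.
Qed.

(** * Soundness *)

Ltac check_entries :=
  let e' := fresh in let He' := fresh in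
  intros e' He'; simpl in He';
  repeat (destruct He' as [<- | He']; [simpl | ]); [.. | destruct He'].

Ltac some_alternative :=
  simpl in *; split_minmax;
  solve [ eexists; split; [left; reflexivity | check_entries; lra]
        | eexists; split; [right; left; reflexivity | check_entries; lra] ].

(** In each rule with a fresh variable [j], some conclusion compares an immediate
    subformula with [j] or [1 - j] alone. Choosing [j] so that this comparison is an
    equality makes the other conclusions of that alternative follow from the premise,
    unless the rule has a purely numerical alternative and that one holds. *)
Lemma rule_preserves_truth B e Cs a v :
  is_valuation v -> (forall n, unit_interval (a n)) -> all_hold a (truth v) B ->
  In e B -> rule B e Cs ->
  exists a' C, (forall n, unit_interval (a' n)) /\ In C Cs /\
    all_hold a' (truth v) (C ++ B).
Proof.
  intros Hv Ha HB He Hrule.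
  (* The premise is reread under the new values [a'], so that the choice of the
     fresh value [r] never has to be compared with the old ones. *)
  assert (Hfresh : forall j r, fresh j B -> unit_interval r ->
    (forall a', a' j = r -> holds a' (truth v) e ->
      exists C, In C Cs /\ all_hold a' (truth v) C) ->
    exists a' C, (forall n, unit_interval (a' n)) /\ In C Cs /\
      all_hold a' (truth v) (C ++ B)).
  { intros j r Hj Hr Hstep.
    destruct (choose_fresh a (truth v) B j r) as (a' & Ha' & HB' & Hr'); auto.
    destruct (Hstep a' Hr' (HB' e He)) as (C & HC & HC').
    exists a', C; rewrite all_hold_app; auto. }
  assert (Hstay : (exists C, In C Cs /\ all_hold a (truth v) C) ->
    exists a' C, (forall n, unit_interval (a' n)) /\ In C Cs /\
      all_hold a' (truth v) (C ++ B)).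
  { intros (C & HC & HC'); exists a, C; rewrite all_hold_app; auto. }
  assert (Hprem := HB e He).
  destruct Hrule as [i|i|i|i|f i|f i|f i|f i
    |f g i j Hj|f g i j Hj|f g i j Hj|f g i j Hj
    |f g i j Hj|f g i j Hj|f g i j Hj|f g i j Hj
    |f g i|f g i|f g i|f g i|f g i|f g i|f g i|f g i];
  try destruct (eval_unit_square v Hv f) as [Hf1 Hf2];
  try destruct (eval_unit_square v Hv g) as [Hg1 Hg2];
  unfold unit_interval in *;
  try (apply Hstay; some_alternative);
  clear Hprem Hstay.
  - apply (Hfresh j (fst (eval v g))); auto; intros; some_alternative.
  - apply (Hfresh j (snd (eval v f))); auto; intros; some_alternative.
  - apply (Hfresh j (fst (eval v g))); auto; intros; some_alternative.
  - apply (Hfresh j (snd (eval v f))); auto; intros; some_alternative.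
  - apply (Hfresh j (fst (eval v g))); auto; intros; some_alternative.
  - apply (Hfresh j (1 - snd (eval v g))); [auto | lra | intros; some_alternative].
  - apply (Hfresh j (fst (eval v g))); auto; intros; some_alternative.
  - apply (Hfresh j (1 - snd (eval v g))); [auto | lra | intros; some_alternative].
Qed.

Lemma tableau_preserves_truth v B (T : tableau B) :
  is_valuation v -> forall a,
  (forall n, unit_interval (a n)) -> all_hold a (truth v) B ->
  exists a' B', (forall n, unit_interval (a' n)) /\ In B' (branches T) /\
    all_hold a' (truth v) B'.
Proof.
  intros Hv.
  induction T as [B|B e C He Hrule T IH|B e C1 C2 He Hrule T1 IH1 T2 IH2];
    intros a Ha HB; simpl.
  - exists a, B; auto.
  - destruct (rule_preserves_truth B e [C] a v) as (a' & C' & Ha' & HC' & HB'); auto.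
    destruct HC' as [<-|[]]; eauto.
  - destruct (rule_preserves_truth B e [C1; C2] a v) as (a' & C' & Ha' & HC' & HB'); auto.
    destruct HC' as [<-|[<-|[]]];
      [destruct (IH1 a') as (a2 & B2 & H1 & H2 & H3)
      |destruct (IH2 a') as (a2 & B2 & H1 & H2 & H3)]; auto;
      exists a2, B2; rewrite in_app_iff; auto.
Qed.

Lemma closed_tableau_root_unsatisfiable B (T : tableau B) v a :
  closed T -> is_valuation v -> (forall n, unit_interval (a n)) ->
  ~ all_hold a (truth v) B.
Proof.
  intros HT Hv Ha HB.
  destruct (tableau_preserves_truth v B T Hv a Ha HB) as (a' & B' & Ha' & HB' & H).
  apply (HT B' HB'); exists a', (truth v).
  split; [exact Ha' | split; [exact (truth_unit_valued v Hv) | exact H]].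
Qed.

Lemma has_proof_valid x y f : has_proof x y f -> valid x y f.
Proof.
  intros [(c & Tc & Hc) (d & Td & Hd)] v Hv.
  assert (Hu := eval_unit_square v Hv f).
  split; [exact Hu | destruct Hu as [Hu1 Hu2]].
  split; apply Rnot_lt_le; intros Hlt.
  (* The root contains no auxiliary variable but its own, so a constant assignment
     with the value of [f] will do. *)
  - apply (closed_tableau_root_unsatisfiable _ Tc v (fun _ => fst (eval v f)));
      auto; check_entries; lra.
  - apply (closed_tableau_root_unsatisfiable _ Td v (fun _ => snd (eval v f)));
      auto; check_entries; lra.
Qed.

(** * Completeness *)

Definition letter_values (X : coord -> formula -> R) : nat -> R * R :=
  fun p => (X K1 (Var p), X K2 (Var p)).

Lemma letter_values_valuation X : unit_valued X -> is_valuation (letter_values X).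
Proof. intros HX p; split; apply HX. Qed.

Definition atomic (e : entry) : Prop :=
  match e with
  | Fle _ (Var _) _ | Fge _ (Var _) _ | Nle _ _ | Nlt _ _ => True
  | _ => False
  end.

Lemma atomic_dec e : atomic e \/ ~ atomic e.
Proof. destruct e as [k [] i|k [] i|i j|i j]; simpl; tauto. Qed.

(** The hypothesis on [X], an arbitrary solution of the branch, serves to bound the
    label of the premise where the conclusions do not; see the introduction. *)
Lemma rule_reflects_truth B e Cs C a v X :
  is_valuation v -> unit_valued X -> holds a X e ->
  rule B e Cs -> In C Cs -> all_hold a (truth v) C -> holds a (truth v) e.
Proof.
  intros Hv HX HXe Hrule HC Hconcl.
  destruct Hrule as [i|i|i|i|f i|f i|f i|f i
    |f g i j Hj|f g i j Hj|f g i j Hj|f g i j Hj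
    |f g i j Hj|f g i j Hj|f g i j Hj|f g i j Hj
    |f g i|f g i|f g i|f g i|f g i|f g i|f g i|f g i];
  try destruct (eval_unit_square v Hv f) as [Hf1 Hf2];
  try destruct (eval_unit_square v Hv g) as [Hg1 Hg2];
  simpl in HXe; unfold unit_interval in *;
  (* [HXu]: the value under [X] of the formula of the premise lies between 0 and 1. *)
  try match type of HXe with
    | context [X ?k ?h] => pose proof (HX k h) as HXu; unfold unit_interval in HXu
    end;
  simpl in HC; repeat destruct HC as [<-|HC]; try contradiction;
  apply Forall_forall in Hconcl; repeat rewrite Forall_cons_iff in Hconcl;
  simpl in *; split_minmax; lra.
Qed.

Lemma letters_reflect_truth a X e :
  atomic e -> holds a X e -> holds a (truth (letter_values X)) e.
Proof.
  destruct e as [[|] [] i|[|] [] i|i j|i j]; simpl; tauto.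
Qed.

(** The weights are such that every alternative of a rule weighs less in total than
    the premise. A binary connective counts 2 and the constant counts 2 because
    their rules may add, besides the immediate subformulas, a numerical constraint,
    which itself weighs 1. *)
Fixpoint formula_weight (f : formula) : nat :=
  match f with
  | Var _ => 1
  | Zero => 2
  | Neg f => 1 + formula_weight f
  | And f g | Or f g | SImp f g | WImp f g =>
      2 + formula_weight f + formula_weight g
  end.

Definition entry_weight (e : entry) : nat :=
  match e with
  | Fle _ f _ | Fge _ f _ => formula_weight f
  | Nle _ _ | Nlt _ _ => 1
  end.

Definition weight (P : list entry) : nat := list_sum (map entry_weight P).

Lemma weight_app P Q : weight (P ++ Q) = (weight P + weight Q)%nat.
Proof. unfold weight; rewrite map_app; apply list_sum_app. Qed.

Lemma compound_decomposes B e :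
  ~ atomic e ->
  (exists C, rule B e [C] /\ (weight C < entry_weight e)%nat) \/
  (exists C1 C2, rule B e [C1; C2] /\
     (weight C1 < entry_weight e)%nat /\ (weight C2 < entry_weight e)%nat).
Proof.
  destruct (fresh_exists B) as [j Hj].
  destruct e as [[|] [] i|[|] [] i|i i'|i i']; simpl; intros He;
    try (exfalso; exact (He I));
    first
      [ left; eexists; split; [constructor; exact Hj | unfold weight; simpl; lia]
      | left; eexists; split; [constructor | unfold weight; simpl; lia]
      | right; do 2 eexists; split;
          [constructor; exact Hj | unfold weight; simpl; lia]
      | right; do 2 eexists; split; [constructor | unfold weight; simpl; lia] ].
Qed.

(** [P] holds the entries still to be decomposed. The hypothesis says that a
    solution of the branch does not make [P] true when formulas are evaluated from
    its values at the letters. This survives each step, since an entry can be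
    dropped from [P] once its conclusions are in [P], or if it is atomic; and for
    [P] empty it says that the branch is closed. *)
Lemma closed_tableau_of_pending P : forall B,
  incl P B ->
  (forall a X, (forall n, unit_interval (a n)) -> unit_valued X ->
     all_hold a X B -> ~ all_hold a (truth (letter_values X)) P) ->
  exists T : tableau B, closed T.
Proof.
  induction P as [P IH]
    using (well_founded_induction (Wf_nat.well_founded_ltof _ weight)).
  unfold Wf_nat.ltof in IH.
  intros B HPB Href.
  destruct P as [|e P].
  { exists (Leaf B); intros B' [<-|[]] (a & X & Ha & HX & HB).
    apply (Href a X Ha HX HB); intros e []. }
  assert (He : In e B) by (apply HPB; now left).
  assert (HP : incl P B) by (intros e' He'; apply HPB; now right).
  change (weight (e :: P)) with (entry_weight e + weight P)%nat in IH.
  assert (Hcons : forall a X, holds a (truth (letter_values X)) e ->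
    all_hold a (truth (letter_values X)) P ->
    all_hold a (truth (letter_values X)) (e :: P)).
  { intros a X H H' e' [<-|He']; auto. }
  destruct (atomic_dec e) as [Hat|Hcomp].
  - apply (IH P); auto.
    + destruct e as [k [] i|k [] i|i j|i j]; simpl; lia.
    + intros a X Ha HX HB HXP; apply (Href a X Ha HX HB), Hcons; auto.
      apply letters_reflect_truth; auto.
  - assert (Hstep : forall Cs C, rule B e Cs -> In C Cs ->
      (weight C < entry_weight e)%nat -> exists T : tableau (C ++ B), closed T).
    { intros Cs C Hrule HC Hw; apply (IH (C ++ P)).
      - rewrite weight_app; lia.
      - apply incl_app_app; [apply incl_refl | exact HP].
      - intros a X Ha HX HB HXP.
        apply all_hold_app in HB as [_ HB]; apply all_hold_app in HXP as [HXC HXP].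
        apply (Href a X Ha HX HB), Hcons; auto.
        apply (rule_reflects_truth B e Cs C a _ X); auto.
        apply letter_values_valuation, HX. }
    destruct (compound_decomposes B e Hcomp)
      as [(C & Hrule & Hw)|(C1 & C2 & Hrule & Hw1 & Hw2)].
    + destruct (Hstep [C] C) as [T HT]; simpl; auto.
      exists (Extend B e C He Hrule T); exact HT.
    + destruct (Hstep [C1; C2] C1) as [T1 HT1]; simpl; auto.
      destruct (Hstep [C1; C2] C2) as [T2 HT2]; simpl; auto.
      exists (Split B e C1 C2 He Hrule T1 T2).
      intros B' HB'; simpl in HB'; apply in_app_iff in HB' as [HB'|HB']; auto.
Qed.

Lemma closed_tableau_exists B :
  (forall a v, is_valuation v -> ~ all_hold a (truth v) B) ->
  exists T : tableau B, closed T.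
Proof.
  intros H; apply (closed_tableau_of_pending B B (incl_refl B)).
  intros a X _ HX _; apply H, letter_values_valuation, HX.
Qed.

Lemma valid_has_proof x y f : valid x y f -> has_proof x y f.
Proof.
  intros Hf; split; exists 0%nat; apply closed_tableau_exists; intros a v Hv HB;
    destruct (Hf v Hv) as [_ [Hx Hy]];
    apply Forall_forall in HB; repeat rewrite Forall_cons_iff in HB; simpl in HB; lra.
Qed.

Theorem theorem1 (x y : R) (hx : 0 <= x <= 1) (hy : 0 <= y <= 1) (f : formula) :
  (over_strong f -> (valid x y f <-> has_proof x y f)) /\
  (over_weak f -> (valid x y f <-> has_proof x y f)).
Proof.
  split; intros _; split; auto using valid_has_proof, has_proof_valid.
Qed.
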